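(* For every integer $n\ge 1$, the monoid $H^+_n=\langle a,b,c \mid b(ab)^nba=cb(ab)^nb,\ ab=bc,\ ac=ca\rangle_{mo}$ is cancellative.
   Context: $\langle L\mid R\rangle_{mo}$ denotes the monoid presented by generators $L$ and relations $R$, i.e. the quotient of the free monoid $L^*$ by the congruence generated by $R$. A monoid $M$ is cancellative if $AXB=AYB$ with $A,B,X,Y\in M$ implies $X=Y$. *)

(* Defs.v *)
From HB Require Import structures.
From mathcomp Require Import all_boot.
From mathcomp Require Import boolp.

Set Implicit Arguments.
Unset Strict Implicit.
Unset Printing Implicit Defensive.

Local Open Scope group_scope.
Local Open Scope quotient_scope.

Definition free_monoid (L : Type) := seq L.

HB.instance Definition _ (L : choiceType) :=
  Choice.copy (free_monoid L) (seq L).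

HB.instance Definition _ (L : choiceType) :=
  isMonoid.Build (free_monoid L) (@catA L) (@cat0s L) (@cats0 L).

Definition letter (L : choiceType) (x : L) : free_monoid L := [:: x].

Section Presentation.
Variables (L : choiceType) (R : seq (free_monoid L * free_monoid L)).

Inductive gen_congr : free_monoid L -> free_monoid L -> Prop :=
| gen_congr_rel u v : (u, v) \in R -> gen_congr u v
| gen_congr_refl u : gen_congr u u
| gen_congr_sym u v : gen_congr u v -> gen_congr v u
| gen_congr_trans u v w : gen_congr u v -> gen_congr v w -> gen_congr u w
| gen_congr_mul u u' v v' :
    gen_congr u u' -> gen_congr v v' -> gen_congr (u * v) (u' * v').

(* [{eq_quot _}] expects a boolean relation, hence the classical [asbool]. *)
Definition gen_congrb : rel (free_monoid L) := fun u v => `[< gen_congr u v >].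

Lemma gen_congrb_refl : reflexive gen_congrb.
Proof. by move=> u; apply/asboolP; exact: gen_congr_refl. Qed.

Lemma gen_congrb_sym : symmetric gen_congrb.
Proof. by move=> u v; apply/asboolP/asboolP; exact: gen_congr_sym. Qed.

Lemma gen_congrb_trans : transitive gen_congrb.
Proof.
move=> v u w /asboolP uv /asboolP vw; apply/asboolP.
exact: gen_congr_trans uv vw.
Qed.

Canonical gen_congrb_equiv :=
  EquivRel gen_congrb gen_congrb_refl gen_congrb_sym gen_congrb_trans.

Definition presented_monoid := {eq_quot gen_congrb}.

HB.instance Definition _ := Choice.on presented_monoid.
HB.instance Definition _ := EqQuotient.on presented_monoid.

Lemma presented_eqP (u v : free_monoid L) :
  \pi_presented_monoid u = \pi_presented_monoid v <-> gen_congr u v.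
Proof.
split=> [/eqP|uv]; first by rewrite piE => /asboolP.
by apply/eqP; rewrite piE; apply/asboolP.
Qed.

Definition presented_mul (x y : presented_monoid) : presented_monoid :=
  \pi_presented_monoid (repr x * repr y).

Lemma presented_mul_pi (u v : free_monoid L) :
  presented_mul (\pi_presented_monoid u) (\pi_presented_monoid v) =
  \pi_presented_monoid (u * v).
Proof.
by apply/presented_eqP; apply: gen_congr_mul; apply/presented_eqP; rewrite reprK.
Qed.

Lemma presented_mulA : associative presented_mul.
Proof.
elim/quotW=> u; elim/quotW=> v; elim/quotW=> w.
by rewrite (presented_mul_pi v w) (presented_mul_pi u v) 2!presented_mul_pi mulgA.
Qed.

Lemma presented_mul1 : left_id (\pi_presented_monoid 1) presented_mul.
Proof. by elim/quotW=> u; rewrite presented_mul_pi mul1g. Qed.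

Lemma presented_mulr1 : right_id (\pi_presented_monoid 1) presented_mul.
Proof. by elim/quotW=> u; rewrite presented_mul_pi mulg1. Qed.

HB.instance Definition _ := isMonoid.Build presented_monoid
  presented_mulA presented_mul1 presented_mulr1.

Lemma presented_piM (u v : free_monoid L) :
  \pi_presented_monoid (u * v) =
  \pi_presented_monoid u * \pi_presented_monoid v.
Proof. by rewrite -presented_mul_pi. Qed.

End Presentation.

Definition cancellative (M : monoidType) : Prop :=
  forall A B X Y : M, A * X * B = A * Y * B -> X = Y.

Inductive H_gen := Ha | Hb | Hc.

Definition H_gen_code (x : H_gen) : option bool :=
  match x with Ha => None | Hb => Some false | Hc => Some true end.

Definition H_gen_decode (x : option bool) : H_gen :=
  match x with None => Ha | Some false => Hb | Some true => Hc end.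

Lemma H_gen_codeK : cancel H_gen_code H_gen_decode.
Proof. by case. Qed.

HB.instance Definition _ := Finite.copy H_gen (can_type H_gen_codeK).

Definition H_rels (n : nat) : seq (free_monoid H_gen * free_monoid H_gen) :=
  let a := letter Ha in let b := letter Hb in let c := letter Hc in
  [:: (b * (a * b) ^+ n * b * a, c * b * (a * b) ^+ n * b);
      (a * b, b * c);
      (a * c, c * a)].

Definition H_monoid (n : nat) : monoidType := presented_monoid (H_rels n).

(* Main.v *)
Require Import Defs.
From mathcomp Require Import all_boot.
From mathcomp Require Import zify.

(* Since ab = bc and ac = ca, a word with m letters b is determined by m
   together with a vector e_0, ..., e_(m+1) of naturals: the empty word gives
   (0, 0), left multiplication by c and a increments e_0 and e_1, and left
   multiplication by b prepends a 0.  The remaining relation lets one chip jump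
   between e_i and e_(i+n+3) whenever the n entries e_(i+2), ..., e_(i+n+1) are
   all equal to 1.  Left cancellation is a statement about this chip game,
   proved by induction on the length of vectors.  The first entry of a vector
   only collects chips emitted by the tail, so it suffices that emission be a
   partial injection on equivalence classes of tails: two equivalent vectors are
   then related by a monotone sequence of emissions, which does not see the
   value of the first entry.  Injectivity at length N rests on the fact that
   three properties of classes (having a representative 1^n.., one 1^n with a
   chip at the emitting position, one with a nonzero first entry) are invariant
   under emission for shorter vectors.
   Right cancellation follows because reversing words and exchanging a and c
   preserves the relations. *)

Set Implicit Arguments.
Unset Strict Implicit.
Unset Printing Implicit Defensive.

(** * The chip game on vectors *)

Section Chips.
Variable n : nat.
Hypothesis n_gt0 : 0 < n.

Definition ones (e : seq nat) := nseq n 1 ++ e.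

Inductive chip_eq : seq nat -> seq nat -> Prop :=
| chip_refl e : chip_eq e e
| chip_sym e f : chip_eq e f -> chip_eq f e
| chip_trans e f g : chip_eq e f -> chip_eq f g -> chip_eq e g
| chip_cons p e f : chip_eq e f -> chip_eq (p :: e) (p :: f)
| chip_move p q s t e :
    chip_eq (p.+1 :: q :: ones (s :: t :: e)) (p :: q :: ones (s :: t.+1 :: e)).

Local Notation "e ~~ f" := (chip_eq e f) (at level 70).
Hint Resolve chip_refl : core.

Definition incr0 (e : seq nat) := if e is p :: e' then p.+1 :: e' else e.
Definition incr1 (e : seq nat) := if e is p :: e' then p :: incr0 e' else e.

Lemma chip_size e f : e ~~ f -> size e = size f.
Proof.
elim=> {e f} //= [e f g _ -> _ -> //|p e f _ -> //|p q s t e].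
by rewrite !size_cat.
Qed.

Lemma chip_incr0 e f : e ~~ f -> incr0 e ~~ incr0 f.
Proof.
elim=> {e f} //= [e f _ /chip_sym //|e f g _ + _|p e f ef _|p q s t e].
- exact: chip_trans.
- exact: chip_cons.
- exact: chip_move.
Qed.

Lemma chip_incr1 e f : e ~~ f -> incr1 e ~~ incr1 f.
Proof.
elim=> {e f} //= [e f _ /chip_sym //|e f g _ + _|p e f ef _|p q s t e].
- exact: chip_trans.
- exact/chip_cons/chip_incr0.
- exact: chip_move.
Qed.

Lemma chip_ones e f : e ~~ f -> ones e ~~ ones f.
Proof. by rewrite /ones; elim: n => //= m IH /IH; exact: chip_cons. Qed.

(** A spare 1 behind the block can be read as a head in front of it, which is the shape [emit] acts
    on. *)
Lemma ones_cons1 e : ones (1 :: e) = 1 :: ones e.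
Proof. by rewrite /ones; elim: n => //= m ->. Qed.

Lemma size_ones e : size (ones e) = n + size e.
Proof. by rewrite size_cat size_nseq. Qed.

(** * Emissions and their iterates *)

(* [emit e f]: prepending one more entry to [e], a chip can leave [e] for that
   entry (see [emit_move]), and [f] remains. *)
Definition emit (e f : seq nat) : Prop := exists q s t g,
  e ~~ q :: ones (s :: t.+1 :: g) /\ q :: ones (s :: t :: g) ~~ f.

Fixpoint emitn k (e f : seq nat) : Prop :=
  if k is k'.+1 then exists2 g, emit e g & emitn k' g f else e ~~ f.

Lemma emit_chipl e e' f : e ~~ e' -> emit e' f -> emit e f.
Proof.
move=> ee' [q [s [t [g [e'q qf]]]]]; exists q, s, t, g; split=> //.
exact: chip_trans ee' e'q.
Qed.

Lemma emit_chipr e f f' : emit e f -> f ~~ f' -> emit e f'.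
Proof.
move=> [q [s [t [g [eq qf]]]]] ff'; exists q, s, t, g; split=> //.
exact: chip_trans qf ff'.
Qed.

Lemma emitn_chipl k e e' f : e ~~ e' -> emitn k e' f -> emitn k e f.
Proof.
case: k => [|k] /= ee'; first exact: chip_trans.
by case=> g e'g gf; exists g => //; exact: emit_chipl e'g.
Qed.

Lemma emitn_chipr k e f f' : emitn k e f -> f ~~ f' -> emitn k e f'.
Proof.
elim: k e => [|k IH] e /=; first exact: chip_trans.
by case=> g eg gf ff'; exists g => //; exact: IH gf ff'.
Qed.

Lemma emitnS k e f : emitn k.+1 e f -> exists2 g, emitn k e g & emit g f.
Proof.
elim: k e => [|k IH] e [g eg gf].
  by exists e => //; exact: emit_chipr eg gf.
by case/IH: gf => h gh hf; exists h => //; exists g.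
Qed.

Lemma emitnD k l e g f : emitn k e g -> emitn l g f -> emitn (k + l) e f.
Proof.
elim: k e => [|k IH] e /=; first exact: emitn_chipl.
by case=> h eh hg gf; exists h => //; exact: IH hg gf.
Qed.

Lemma emit_size e f : emit e f -> size e = size f.
Proof.
case=> q [s [t [g [/chip_size -> /chip_size <-]]]].
by rewrite /= !size_ones.
Qed.

Lemma emitn_size k e f : emitn k e f -> size e = size f.
Proof.
elim: k e => [|k IH] e /=; first exact: chip_size.
by case=> g /emit_size -> /IH.
Qed.

Lemma emit_move p e f : emit e f -> p :: e ~~ p.+1 :: f.
Proof.
case=> q [s [t [g [eq qf]]]].
apply: chip_trans (chip_cons p eq) _.
apply: chip_trans (chip_sym (chip_move p q s t g)) _.
exact: chip_cons qf.
Qed.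

Lemma emitn_move k p e f : emitn k e f -> p :: e ~~ (p + k) :: f.
Proof.
elim: k p e => [|k IH] p e /=; first by rewrite addn0; exact: chip_cons.
case=> g /emit_move eg /IH gf; apply: chip_trans (eg p) _.
by rewrite addnS -addSn.
Qed.

(** Read from right to left, this makes emission single-valued on classes; from left to right,
    injective. *)
Definition emit_injective N := forall q s t e q' s' t' e',
  size (q :: ones (s :: t :: e)) = N ->
  q :: ones (s :: t :: e) ~~ q' :: ones (s' :: t' :: e') <->
  q :: ones (s :: t.+1 :: e) ~~ q' :: ones (s' :: t'.+1 :: e').

Lemma emit_value e f q s t g : emit_injective (size e) -> emit e f ->
  e ~~ q :: ones (s :: t.+1 :: g) -> f ~~ q :: ones (s :: t :: g).
Proof.
move=> inj [q' [s' [t' [g' [eq' q'f]]]]] eq.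
apply: chip_trans (chip_sym q'f) _; apply: (iffRL (inj _ _ _ _ _ _ _ _ _)).
  by rewrite (chip_size eq') /= !size_ones.
exact: chip_trans (chip_sym eq') eq.
Qed.

Lemma emit_covalue e f q s t g : emit_injective (size e) -> emit e f ->
  f ~~ q :: ones (s :: t :: g) -> e ~~ q :: ones (s :: t.+1 :: g).
Proof.
move=> inj [q' [s' [t' [g' [eq' q'f]]]]] fq.
apply: chip_trans (eq') _; apply: (iffLR (inj _ _ _ _ _ _ _ _ _)).
  by rewrite (chip_size eq') /= !size_ones.
exact: chip_trans q'f fq.
Qed.

Lemma emit_fun e f f' : emit_injective (size e) ->
  emit e f -> emit e f' -> f ~~ f'.
Proof.
move=> inj ef [q [s [t [g [eq qf']]]]].
exact: chip_trans (emit_value inj ef eq) qf'.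
Qed.

Lemma emit_inj e e' f : emit_injective (size e) ->
  emit e f -> emit e' f -> e ~~ e'.
Proof.
move=> inj ef [q [s [t [g [e'q qf]]]]].
apply: chip_trans (emit_covalue inj ef (chip_sym qf)) (chip_sym e'q).
Qed.

Lemma emitn_fun k l e g f : emit_injective (size e) ->
  emitn k e g -> emitn (k + l) e f -> emitn l g f.
Proof.
elim: k e => [|k IH] e inj /=.
  by move=> /chip_sym; exact: emitn_chipl.
case=> h eh hg [h' eh' h'f].
apply: (IH h) => //; first by rewrite -(emit_size eh).
exact: emitn_chipl (emit_fun inj eh eh') h'f.
Qed.

Lemma emitn_inj k l e g f : emit_injective (size g) ->
  emitn k g f -> emitn (l + k) e f -> emitn l e g.
Proof.
elim: k f => [|k IH] f inj.
  by rewrite addn0 => gf ef; exact: emitn_chipr ef (chip_sym gf).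
case/emitnS=> h gh hf; rewrite addnS => /emitnS[h' eh' h'f].
apply: (IH h) => //; apply: emitn_chipr eh' _.
by apply: chip_sym; apply: emit_inj hf h'f; rewrite -(emitn_size gh).
Qed.

(** * Equivalence as a monotone run of emissions *)

Definition linked p e q f :=
  (exists2 k, q = p + k & emitn k e f) \/ (exists2 k, p = q + k & emitn k f e).

Lemma linked_trans p e q f r g : emit_injective (size f) ->
  linked p e q f -> linked q f r g -> linked p e r g.
Proof.
move=> inj [] [k -> ef] [] [l].
- by move=> -> fg; left; exists (k + l); [rewrite addnA | exact: emitnD ef fg].
(* Two runs end at [f]: by injectivity the shorter is a final segment of the longer. *)
- move=> pk gf; have [kl|lk] := leqP k l.
    right; exists (l - k); first lia.
    apply: emitn_inj (ef) _; last by rewrite subnK.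
    by rewrite (emitn_size ef).
  left; exists (k - l); first lia.
  apply: emitn_inj (gf) _; last by rewrite subnK // ltnW.
  by rewrite (emitn_size gf).
(* Two runs start at [f]: the shorter is an initial segment of the longer. *)
- move=> -> fg; have [kl|lk] := leqP k l.
    left; exists (l - k); first lia.
    by apply: emitn_fun ef _ => //; rewrite subnKC.
  right; exists (k - l); first lia.
  by apply: emitn_fun fg _ => //; rewrite subnKC // ltnW.
- by move=> -> gf; right; exists (l + k); [lia | exact: emitnD gf ef].
Qed.

(** Induction on the derivation: a move at the head is one emission, a move inside the tail is a run
    of length 0, and runs compose by [linked_trans]. *)
Lemma chip_linked_aux u v : u ~~ v -> forall p e q f, u = p :: e -> v = q :: f ->
  emit_injective (size e) -> linked p e q f.
Proof.
elim=> {u v}.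
- by move=> _ p e q f -> [-> ->] _; left; exists 0; rewrite ?addn0.
- move=> u v uv IH p e q f vE uE inj.
  case: (IH q f p e uE vE) => [|?|?]; [|by right|by left].
  by have := chip_size uv; rewrite vE uE => -[->].
- move=> u v w uv IHu vw IHv p e q f uE wE inj.
  have := chip_size uv; rewrite uE; case: v uv vw IHu IHv => // r g uv vw IHu IHv [eg].
  apply: (@linked_trans _ _ r g); first by rewrite -eg.
    exact: IHu.
  by apply: IHv => //; rewrite -eg.
- by move=> p e f ef _ p' e' q f' [<- <-] [<- <-] _; left; exists 0; rewrite ?addn0.
move=> p q s t g p' e q' f [<- <-] [<- <-] _; right; exists 1; first by rewrite addn1.
exists (q :: ones (s :: t :: g)) => /=; last by [].
by exists q, s, t, g.
Qed.

Lemma chip_linked p e q f :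
  emit_injective (size e) -> p :: e ~~ q :: f -> linked p e q f.
Proof. by move=> inj pq; exact: chip_linked_aux pq _ _ _ _ _ _ inj. Qed.

(** * Class properties stable under emission *)

Definition open e := exists s t g, e ~~ ones (s :: t :: g).
(** If [e] is loaded, every [q :: e] can emit; if [e] is open, every [q :: e] results from some
    emission. *)
Definition loaded e := exists s t g, e ~~ ones (s :: t.+1 :: g).
Definition positive e := exists t g, e ~~ t.+1 :: g.

Definition stable (P : seq nat -> Prop) N :=
  forall e f, size e = N -> emit e f -> P e <-> P f.

Definition tame N := [/\ emit_injective N, stable open N, stable loaded N
  & stable positive N].

Lemma open_chip e f : e ~~ f -> open e -> open f.
Proof.
by move=> /chip_sym fe [s [t [g eg]]]; exists s, t, g; exact: chip_trans fe eg.
Qed.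

Lemma loaded_chip e f : e ~~ f -> loaded e -> loaded f.
Proof.
by move=> /chip_sym fe [s [t [g eg]]]; exists s, t, g; exact: chip_trans fe eg.
Qed.

Lemma positive_chip e f : e ~~ f -> positive e -> positive f.
Proof.
by move=> /chip_sym fe [t [g eg]]; exists t, g; exact: chip_trans fe eg.
Qed.

Lemma stable_linked P p e q f :
  (forall e f, e ~~ f -> P e -> P f) -> stable P (size e) ->
  linked p e q f -> P e -> P f.
Proof.
move=> Pchip Pst.
have st k x y : size x = size e -> emitn k x y -> P x <-> P y.
  elim: k x => [|k IH] x xe /=.
    by move=> xy; split; apply: Pchip => //; exact: chip_sym.
  case=> z xz zy; apply: (iff_trans (Pst _ _ xe xz)).
  by apply: IH => //; rewrite -(emit_size xz).
case=> [] [k _ ef]; first by case: (st _ _ _ erefl ef).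
by case: (st _ _ _ (emitn_size ef) ef).
Qed.

(** * The induction step on the length *)

Section Induction.
Variable N : nat.
Hypothesis IHN : forall m, m < N -> tame m.

Let injN m : m < N -> emit_injective m. Proof. by case/IHN. Qed.

(** The two tails are joined by a run of emissions, along which a stable property persists. *)
Lemma transfer_open p e q f : size e < N -> p :: e ~~ q :: f -> open f -> open e.
Proof.
move=> eN pq; have [inj st _ _] := IHN eN.
have sf : size e = size f by case: (chip_size pq).
apply: stable_linked (chip_linked _ (chip_sym pq)); rewrite -?sf //.
exact: open_chip.
Qed.

Lemma transfer_loaded p e q f :
  size e < N -> p :: e ~~ q :: f -> loaded f -> loaded e.
Proof.
move=> eN pq; have [inj _ st _] := IHN eN.
have sf : size e = size f by case: (chip_size pq).
apply: stable_linked (chip_linked _ (chip_sym pq)); rewrite -?sf //.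
exact: loaded_chip.
Qed.

Lemma transfer_positive p e q f :
  size e < N -> p :: e ~~ q :: f -> positive f -> positive e.
Proof.
move=> eN pq; have [inj _ _ st] := IHN eN.
have sf : size e = size f by case: (chip_size pq).
apply: stable_linked (chip_linked _ (chip_sym pq)); rewrite -?sf //.
exact: positive_chip.
Qed.

(** Equal heads force the run between the tails to have length 0. *)
Lemma cancel_cons p e f : size e < N -> p :: e ~~ p :: f -> e ~~ f.
Proof.
move=> /injN inj /(chip_linked inj)[] [k pk] ef; have k0 : k = 0 by lia.
  by rewrite k0 in ef.
by rewrite k0 in ef; exact: chip_sym.
Qed.

Lemma cancel_incr0 p e q f : size e < N -> p.+1 :: e ~~ q.+1 :: f -> p :: e ~~ q :: f.
Proof.
move=> /injN inj /(chip_linked inj)[] [k pk] ef.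
  by have -> : q = p + k by [lia]; exact: emitn_move.
by have -> : p = q + k by [lia]; exact/chip_sym/emitn_move.
Qed.

Lemma cancel_ones e f : size (ones e) <= N -> ones e ~~ ones f -> e ~~ f.
Proof.
rewrite /ones; elim: n => //= m IH eN ef.
by apply: IH (cancel_cons _ ef); first exact: ltnW.
Qed.

Lemma emit_loaded p e f : size e < N -> emit (p :: e) f -> loaded e.
Proof.
move=> eN [q [s [t [g [pq _]]]]]; apply: transfer_loaded pq _ => //.
by exists s, t, g.
Qed.

Lemma emit_open p e f : size e < N -> emit f (p :: e) -> open e.
Proof.
move=> eN [q [s [t [g [_ /chip_sym pq]]]]]; apply: transfer_open pq _ => //.
by exists s, t, g.
Qed.

Lemma emitn_cancel_incr0 k p e q f : size e < N.-1 ->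
  emitn k (p.+1 :: e) (q.+1 :: f) -> emitn k (p :: e) (q :: f).
Proof.
elim: k p e => [|k IH] p e eN /=; first by apply: cancel_incr0; lia.
case=> g eg gf; have eN' : size e < N by lia.
have [s [t [h eh]]] := emit_loaded eN' eg.
have gE : g ~~ p.+1 :: ones (s :: t :: h).
  by apply: emit_value eg (chip_cons _ eh); apply: injN => /=; lia.
exists (p :: ones (s :: t :: h)).
  by exists p, s, t, h; split=> //; exact: chip_cons.
apply: IH; last exact: emitn_chipl (chip_sym gE) gf.
by have := chip_size eh; rewrite !size_ones /= => <-.
Qed.

Lemma cancel_incr1 p t e q u f : (size e).+1 < N ->
  p :: t.+1 :: e ~~ q :: u.+1 :: f -> p :: t :: e ~~ q :: u :: f.
Proof.
move=> eN /chip_linked[|[k -> ef]|[k -> ef]]; first exact: injN.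
  by apply: emitn_move; apply: emitn_cancel_incr0 ef; lia.
apply/chip_sym/emitn_move; apply: emitn_cancel_incr0 (ef).
by have [->] := emitn_size ef; lia.
Qed.

Lemma both_positive p e q t f : size e < N ->
  p.+1 :: e ~~ q :: t.+1 :: f -> exists u g, p.+1 :: e ~~ p.+1 :: u.+1 :: g.
Proof.
move=> eN pq; have [|u [g ug]] := transfer_positive eN pq; first by exists t, f.
by exists u, g; exact: chip_cons.
Qed.

Lemma ones_head e : exists e', ones e = 1 :: e'.
Proof. by rewrite /ones; case: n n_gt0 => // m _; eexists. Qed.

(* The two positive entries [x.+1] and [y.+1] let a chip be removed from [t] and
   an emission take place independently of each other. *)
Lemma emit_ones s t e f : emit_injective (size (ones (s :: t.+1 :: e))) ->
  size (ones (s :: t.+1 :: e)) <= N ->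
  emit (ones (s :: t.+1 :: e)) f -> exists x y g,
  s :: t.+1 :: e ~~ 1 :: x.+1 :: y.+1 :: g /\ f ~~ ones (1 :: x.+1 :: y :: g).
Proof.
move=> inj leN ef.
have /= sN : (size (s :: t.+1 :: e)) < N.+1.
  by rewrite size_ones in leN; move: leN; lia.
have [e' eE] := ones_head (s :: t.+1 :: e).
have [x [y [g e'g]]] : loaded e'.
  by rewrite eE in ef leN; exact: emit_loaded ef.
have Te : s :: t.+1 :: e ~~ 1 :: x :: y.+1 :: g.
  by apply: cancel_ones => //; rewrite ones_cons1 eE; exact: chip_cons.
have /= sg := chip_size Te.
have [a [b xb]] : positive (x :: y.+1 :: g).
  by apply: transfer_positive (chip_sym Te) _; [rewrite /=; lia|exists t, e].
have [u [h bh]] : exists u h, a.+1 :: b ~~ a.+1 :: u.+1 :: h.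
  apply: both_positive (chip_sym xb); have /= := chip_size xb; lia.
have Th := chip_trans Te (chip_cons 1 (chip_trans xb bh)).
exists a, u, h; split=> //.
rewrite ones_cons1; apply: emit_value ef _ => //.
by rewrite -ones_cons1; exact: chip_ones.
Qed.

(** Behind its leading 1 the result of the emission is open, so a further block of [n] ones follows
    that 1; cancelling a common block of [n] ones leaves the extra 1. *)
Lemma coemit_ones s t e f : emit_injective (size (ones (s :: t :: e))) ->
  size (ones (s :: t :: e)) <= N ->
  emit f (ones (s :: t :: e)) -> exists x y g,
  s :: t :: e ~~ 1 :: x :: y :: g /\ f ~~ ones (1 :: x :: y.+1 :: g).
Proof.
move=> inj leN ef.
have [e' eE] := ones_head (s :: t :: e).
have [x [y [g e'g]]] : open e'.
  by rewrite eE in ef leN; exact: emit_open ef.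
have Te : ones (s :: t :: e) ~~ ones (1 :: x :: y :: g).
  by rewrite ones_cons1 eE; exact: chip_cons.
exists x, y, g; split; first exact: cancel_ones Te.
rewrite ones_cons1 in Te; rewrite ones_cons1; apply: emit_covalue (ef) Te.
by rewrite (emit_size ef).
Qed.

(** Intermediate vectors stay open. In the form [1 :: x :: y.+1 :: h] the extra chip goes to [x]
    while the emission takes one from the next entry, so the two operations commute. *)
Lemma emitn_ones_incr1 k s t e s' t' e' :
  size (ones (s :: t :: e)) < N ->
  emitn k (ones (s :: t :: e)) (ones (s' :: t' :: e')) ->
  emitn k (ones (s :: t.+1 :: e)) (ones (s' :: t'.+1 :: e')).
Proof.
elim: k s t e => [|k IH] s t e ltN /=.
  by move=> /(cancel_ones (ltnW ltN)) /chip_incr1 /chip_ones.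
case=> g eg gf; have eN := emit_size eg.
have [x0 [y0 [h0 gh0]]] : open g.
  have [_ st _ _] := IHN ltN.
  by case: (st _ _ erefl eg) => + _; apply; exists s, t, e.
have [||x [y [h [Th eh]]]] := coemit_ones _ _ (emit_chipr eg gh0).
- by apply: injN; rewrite -(chip_size gh0) -eN.
- by rewrite -(chip_size gh0) -eN ltnW.
have T : s :: t :: e ~~ 1 :: x :: y.+1 :: h by apply: cancel_ones eh; exact: ltnW.
exists (ones (1 :: x.+1 :: y :: h)).
  exists 1, x.+1, y, h; rewrite -!ones_cons1; split=> //.
  exact/chip_ones/(chip_incr1 T).
apply: IH; last exact: emitn_chipl (chip_sym (chip_trans gh0 (chip_ones Th))) gf.
by have /= [eh'] := chip_size T; rewrite !size_ones /= in ltN *; lia.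
Qed.

(** The same commutation backwards; [emit_ones] provides a chip to remove besides the one
    emitted. *)
Lemma emitn_ones_decr1 k s t e s' t' e' :
  size (ones (s :: t :: e)) < N ->
  emitn k (ones (s :: t.+1 :: e)) (ones (s' :: t'.+1 :: e')) ->
  emitn k (ones (s :: t :: e)) (ones (s' :: t' :: e')).
Proof.
elim: k s t e => [|k IH] s t e ltN /=.
  rewrite size_ones /= in ltN => H; apply/chip_ones/cancel_incr1; first lia.
  by apply: cancel_ones H; rewrite size_ones /=; lia.
case=> g eg gf.
have [||x [y [h [Th gh]]]] := emit_ones _ _ eg.
- by apply: injN; rewrite !size_ones in ltN *.
- by apply: ltnW; rewrite !size_ones in ltN *.
have T : s :: t :: e ~~ 1 :: x :: y.+1 :: h.
  by apply: cancel_incr1 Th; rewrite size_ones /= in ltN; lia.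
exists (ones (1 :: x :: y :: h)).
  exists 1, x, y, h; rewrite -!ones_cons1; split=> //.
  exact: chip_ones.
apply: IH; last exact: emitn_chipl (chip_sym gh) gf.
by have /= := chip_size T; rewrite !size_ones /= in ltN * => -[<-].
Qed.

(** Either equivalence is a run between the shorter tails, and the two preceding lemmas carry it
    over with the same length and the same heads. *)
Lemma injective_top : emit_injective N.
Proof.
move=> q s t e q' s' t' e' /= eN; split=> H.
- have [|[k qk]|[k qk]] := chip_linked _ H; first by apply: injN; rewrite -eN.
  + move=> /emitn_ones_incr1 ef; rewrite qk; apply: emitn_move; apply: ef.
    by rewrite -eN.
  + move=> ef; rewrite qk; apply/chip_sym/emitn_move/emitn_ones_incr1 => //.
    by rewrite (emitn_size ef) -eN.
- have [|[k qk]|[k qk]] := chip_linked _ H.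
  + by apply: injN; rewrite -eN !size_ones.
  + move=> /emitn_ones_decr1 ef; rewrite qk; apply: emitn_move; apply: ef.
    by rewrite -eN.
  + move=> ef; rewrite qk; apply/chip_sym/emitn_move/emitn_ones_decr1 => //.
    by have := emitn_size ef; rewrite -eN !size_ones /= => ->.
Qed.

(** Around an emission, a block of [n] ones can be extended to [n.+1] ones; the moving chip lies
    behind them. *)
Lemma stable_open_top : stable open N.
Proof.
move=> e f eN ef; have fN := emit_size ef.
split=> -[s [t [g eg]]].
- have ef' := emit_chipl (chip_sym eg) ef.
  have [e' eE] := ones_head (s :: t :: g).
  have e'N : size e' < N by rewrite -eN (chip_size eg) eE /=.
  rewrite eE in ef' eg; have [x [y [h e'h]]] := emit_loaded e'N ef'.
  exists 1, x, (y :: h); rewrite ones_cons1.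
  apply: emit_value ef _; first by rewrite eN; exact: injective_top.
  exact: chip_trans eg (chip_cons 1 e'h).
- have ef' := emit_chipr ef eg.
  have gN : size (ones (s :: t :: g)) = N by rewrite -(chip_size eg) -fN.
  have [||x [y [h [_ eh]]]] := coemit_ones _ _ ef'; rewrite ?gN //.
    exact: injective_top.
  by exists 1, x, (y.+1 :: h).
Qed.

Lemma stable_loaded_top : stable loaded N.
Proof.
move=> e f eN ef; have fN := emit_size ef.
split=> -[s [t [g eg]]].
- have ef' := emit_chipl (chip_sym eg) ef.
  have gN : size (ones (s :: t.+1 :: g)) = N by rewrite -(chip_size eg).
  have [||x [y [h [_ fh]]]] := emit_ones _ _ ef'; rewrite ?gN //.
    exact: injective_top.
  by exists 1, x, (y :: h).
- have ef' := emit_chipr ef eg.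
  have gN : size (ones (s :: t.+1 :: g)) = N by rewrite -(chip_size eg) -fN.
  have [||x [y [h [Th eh]]]] := coemit_ones _ _ ef'; rewrite ?gN //.
    exact: injective_top.
  (* The chip [t.+1] becomes a positive first entry of this tail; restoring the emitted chip at the
     second entry does not disturb it. *)
  have [a [b xb]] : positive (x :: y :: h).
    apply: transfer_positive (chip_sym Th) _; last by exists t, g.
    by have /= [<-] := chip_size Th; rewrite -gN size_ones /=; lia.
  case: b xb => [|b c] xb; first by have := chip_size xb.
  exists 1, a, (b.+1 :: c); apply: chip_trans eh _.
  by apply/chip_ones/chip_cons; exact: (chip_incr1 xb).
Qed.

(** With a loaded (resp. open) tail, the emission can be realised without touching the positive
    head. *)
Lemma stable_positive_top : stable positive N.
Proof.
move=> e f eN ef; have fN := emit_size ef.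
split=> -[t [g eg]].
- have ef' := emit_chipl (chip_sym eg) ef.
  have gN : size g < N by rewrite -eN (chip_size eg).
  have [x [y [h gh]]] := emit_loaded gN ef'.
  exists t, (ones (x :: y :: h)); apply: emit_value ef _.
    by rewrite eN; exact: injective_top.
  exact: chip_trans eg (chip_cons _ gh).
- have ef' := emit_chipr ef eg.
  have gN : size g < N by rewrite -eN fN (chip_size eg).
  have [x [y [h gh]]] := emit_open gN ef'.
  exists t, (ones (x :: y.+1 :: h)); apply: emit_covalue ef _.
    by rewrite eN; exact: injective_top.
  exact: chip_trans eg (chip_cons _ gh).
Qed.

Lemma tame_top : tame N.
Proof.
split; [exact: injective_top | exact: stable_open_top
  | exact: stable_loaded_top | exact: stable_positive_top].
Qed.
End Induction.

(** * Cancellation in the chip game *)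

Lemma tameP N : tame N.
Proof. by elim/ltn_ind: N => N; exact: tame_top. Qed.

Lemma chip_cancel_cons p e f : p :: e ~~ p :: f -> e ~~ f.
Proof. exact: (cancel_cons (fun m _ => tameP m) (leqnn _)). Qed.

Lemma chip_cancel_incr0 e f : incr0 e ~~ incr0 f -> e ~~ f.
Proof.
move=> ef; have := chip_size ef.
case: e f ef => [|p e] [|q f] //= ef _.
exact: (cancel_incr0 (fun m _ => tameP m) (leqnn _)) ef.
Qed.

Lemma chip_cancel_incr1 e f : incr1 e ~~ incr1 f -> e ~~ f.
Proof.
move=> ef; have := chip_size ef.
case: e f ef => [|p [|t e]] [|q [|u f]] //= ef _.
exact: (cancel_incr1 (fun m _ => tameP m) (leqnn _)) ef.
Qed.

End Chips.

(** * From the chip game to the monoid *)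

Section Monoid.
Local Open Scope group_scope.
Local Open Scope quotient_scope.

Definition act (x : H_gen) : seq nat -> seq nat :=
  match x with Ha => incr1 | Hb => cons 0 | Hc => incr0 end.

Definition chips (u : free_monoid H_gen) : seq nat := foldr act [:: 0; 0] u.

Variable n : nat.

Local Notation H := (presented_monoid (H_rels n)).
Local Notation pi := (\pi_H).

Definition gen (x : H_gen) : H := pi (letter x).
Local Notation a := (gen Ha).
Local Notation b := (gen Hb).
Local Notation c := (gen Hc).

Lemma pi_cons x u : pi (x :: u : free_monoid H_gen) = gen x * pi u.
Proof. exact: presented_piM (letter x) u. Qed.

Lemma pi_exp u k : pi (u ^+ k) = pi u ^+ k.
Proof. by elim: k => [|k IH]; rewrite ?expg0 // !expgS presented_piM IH. Qed.

Lemma gen_ab : a * b = b * c.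
Proof.
rewrite -!presented_piM; apply/presented_eqP/gen_congr_rel.
by rewrite !inE eqxx orbT.
Qed.

Lemma gen_ac : a * c = c * a.
Proof.
rewrite -!presented_piM; apply/presented_eqP/gen_congr_rel.
by rewrite !inE eqxx !orbT.
Qed.

Lemma gen_long : b * (a * b) ^+ n * b * a = c * b * (a * b) ^+ n * b.
Proof.
have /presented_eqP := gen_congr_rel (mem_head _ _ : _ \in H_rels n).
by rewrite !presented_piM !pi_exp !presented_piM.
Qed.

(** The normal form c^e_0 b c^e_1 b ... b c^e_m a^e_(m+1); the size test omits [b] between the last
    two powers. *)
Fixpoint word (e : seq nat) : H :=
  match e with
  | [::] => 1
  | [:: p] => a ^+ p
  | p :: e' => c ^+ p * (if size e' == 1%N then 1 else b) * word e'
  end.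

Lemma word_cons p q r e :
  word (p :: q :: r :: e) = c ^+ p * b * word (q :: r :: e).
Proof. by []. Qed.

Lemma word_pair p q : word [:: p; q] = c ^+ p * a ^+ q.
Proof. by rewrite /= mulg1. Qed.

Lemma word_incr0 p q e : word (p.+1 :: q :: e) = c * word (p :: q :: e).
Proof. by rewrite /= expgS !mulgA. Qed.

Lemma ac_expr k : a * c ^+ k = c ^+ k * a.
Proof. exact: (commuteX _ gen_ac). Qed.

Lemma ab_expr k : b * c ^+ k = a ^+ k * b.
Proof.
elim: k => [|k IH]; first by rewrite mulg1 mul1g.
by rewrite !expgS mulgA -gen_ab -mulgA IH mulgA.
Qed.

(** The new [a] passes c^p; it then either crosses a [b] and becomes a [c], or joins the final power
    of [a]. *)
Lemma word_incr1 p q e : word (p :: q.+1 :: e) = a * word (p :: q :: e).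
Proof.
case: e => [|r e]; first by rewrite !word_pair expgS !mulgA ac_expr.
rewrite !word_cons word_incr0 !mulgA ac_expr -!mulgA.
by rewrite (mulgA b c) -gen_ab -mulgA.
Qed.

(** The block of ones reads (bc)^n = (ab)^n, and the chip at [t] is a factor [a] left of
    [word (s :: t :: e)]. Sliding c^q leftwards through [b] as a^q leaves the long relation. *)
Lemma word_move p q s t e :
  word (p.+1 :: q :: ones n (s :: t :: e)) =
  word (p :: q :: ones n (s :: t.+1 :: e)).
Proof.
have onesE m k u v f : word (k :: nseq m 1%N ++ u :: v :: f) =
    c ^+ k * (b * c) ^+ m * b * word (u :: v :: f).
  elim: m k => [|m IH] k; first by rewrite mulg1 word_cons.
  have <- : c ^+ k * b * word (1%N :: nseq m 1%N ++ u :: v :: f) =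
    word (k :: nseq m.+1 1%N ++ u :: v :: f) by case: m {IH}.
  by rewrite IH expg1 expgS !mulgA.
have consE k u v f : word (k :: q :: ones n (u :: v :: f)) =
    c ^+ k * b * word (q :: ones n (u :: v :: f)).
  by rewrite /ones; case: (nseq n 1%N).
rewrite !consE /ones !onesE word_incr1 expgSr -gen_ab.
have long : b * ((a * b) ^+ n * (b * a)) = c * (b * ((a * b) ^+ n * b)).
  by have := gen_long; rewrite -!mulgA.
have bX z : b * (c ^+ q * z) = a ^+ q * (b * z) by rewrite !mulgA ab_expr.
have cX z : c * (a ^+ q * z) = a ^+ q * (c * z).
  by rewrite !mulgA; congr (_ * z); exact: (commuteX _ (esym gen_ac)).
rewrite -!mulgA !bX cX; do 2 congr (_ * _).
have := congr1 (fun z => z * word (s :: t :: e)) long.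
by rewrite -!mulgA => ->.
Qed.

Lemma word_chip e f : chip_eq n e f -> word e = word f.
Proof.
elim=> {e f} [//|e f _ ->//|e f g _ -> _ ->//|p e f ef IH|p q s t e].
  have := chip_size ef; case: e f ef IH => [|q e] [|r f] //= _ -> sz.
  by rewrite sz.
exact: word_move.
Qed.

Lemma size_chips u : 1 < size (chips u).
Proof.
elim: u => //= -[] u /=; last by case: (chips u).
  by case: (chips u) => [|? []].
exact: leqW.
Qed.

Lemma word_chips u : word (chips u) = pi u.
Proof.
elim: u => [|x u IH]; first by rewrite word_pair !expg0 mulg1.
rewrite pi_cons -IH [chips _]/= -/(chips u); have := size_chips u.
case: (chips u) => [|p [|q e]] // _.
by case: x; [exact: word_incr1 | rewrite [act _ _]/= word_cons mul1g
  | exact: word_incr0].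
Qed.

Lemma act_chip x e f : chip_eq n e f -> chip_eq n (act x e) (act x f).
Proof. by case: x; [exact: chip_incr1|exact: chip_cons|exact: chip_incr0]. Qed.

Lemma act_ab_exp k r :
  foldr act (0%N :: r) ((letter Ha * letter Hb) ^+ k) = 0%N :: nseq k 1%N ++ r.
Proof. by elim: k => //= k IH; rewrite expgS foldr_cat IH. Qed.

(** The start [e] is arbitrary so that the induction passes through products; two entries are
    required to serve as [s] and [t] in a move. *)
Lemma congr_chip u v e : gen_congr (H_rels n) u v -> 1 < size e ->
  chip_eq n (foldr act e u) (foldr act e v).
Proof.
have sz w f : 1 < size f -> 1 < size (foldr act f w).
  move=> szf; elim: w => //= -[] w /=.
  - by case: (foldr _ _ _) => [|? []].
  - exact: leqW.
  - by case: (foldr _ _ _).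
move=> uv; elim: uv e => {u v}.
- move=> u v; rewrite !inE => /or3P[] /eqP[-> ->] [|p [|q e]] // _.
  (* The two sides yield 0, 0, 1^n, p, q+1, ... and 1, 0, 1^n, p, q, ..., which differ by one
     move. *)
  + rewrite /= !foldr_cat /= !act_ab_exp /=; exact/chip_sym/chip_move.
  + exact: chip_refl.
  + exact: chip_refl.
- by move=> u e _; exact: chip_refl.
- by move=> u v _ IH e /IH /chip_sym.
- by move=> u v w _ IH1 _ IH2 e szf; apply: chip_trans (IH1 e szf) (IH2 e szf).
move=> u u' v v' _ IH1 _ IH2 e szf; rewrite !foldr_cat.
apply: chip_trans (IH1 _ (sz _ _ szf)) _.
by elim: u' {IH1} => [|x u' IH] /=; [exact: IH2 | exact: act_chip].
Qed.

Lemma eq_pi_chip u v : pi u = pi v <-> chip_eq n (chips u) (chips v).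
Proof.
split=> [/presented_eqP uv|/word_chip]; first exact: congr_chip.
by rewrite !word_chips.
Qed.

Hypothesis n_gt0 : 0 < n.

Lemma gen_cancel x (X Y : H) : gen x * X = gen x * Y -> X = Y.
Proof.
rewrite -[X]reprK -[Y]reprK -!pi_cons => /eq_pi_chip XY; apply/eq_pi_chip.
by move: XY; case: x; [exact: chip_cancel_incr1|exact: chip_cancel_cons|exact: chip_cancel_incr0].
Qed.

Lemma left_cancel (A X Y : H) : A * X = A * Y -> X = Y.
Proof.
rewrite -[A]reprK; elim: (repr A : seq _) => [|x u IH]; first by rewrite !mul1g.
by rewrite pi_cons -!mulgA => /gen_cancel.
Qed.

(** * Right cancellation by the mirror symmetry *)

Definition swap x := match x with Ha => Hc | Hb => Hb | Hc => Ha end.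
Definition mirror (u : free_monoid H_gen) : free_monoid H_gen := rev (map swap u).

Lemma mirrorK : involutive mirror.
Proof.
by move=> u; rewrite /mirror map_rev revK -map_comp map_id_in => [|[]].
Qed.

Lemma mirrorM u v : mirror (u * v) = mirror v * mirror u.
Proof. by rewrite /mirror map_cat rev_cat. Qed.

Lemma mirrorX u k : mirror (u ^+ k) = mirror u ^+ k.
Proof.
by elim: k => // k IH; rewrite expgSr mirrorM IH expgS.
Qed.

(** The relation ab = bc is reversed and ac = ca is fixed; the long relation becomes cb(bc)^n b =
    b(bc)^n ba, which is its own reverse once bc is replaced by ab. *)
Lemma mirror_congr u v :
  gen_congr (H_rels n) u v -> gen_congr (H_rels n) (mirror u) (mirror v).
Proof.
elim=> {u v}.
- move=> u v; rewrite !inE => uv; apply/presented_eqP.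
  have lab : pi (letter Hb * letter Hc) = pi (letter Ha * letter Hb).
    by rewrite !presented_piM gen_ab.
  case/or3P: uv => /eqP[-> ->]; rewrite !mirrorM ?mirrorX ?mirrorM.
  + rewrite !presented_piM !pi_exp lab presented_piM !mulgA.
    exact: esym gen_long.
  + exact: lab.
  + by rewrite !presented_piM; exact: gen_ac.
- by move=> u; exact: gen_congr_refl.
- by move=> u v _; exact: gen_congr_sym.
- by move=> u v w _ uv _; exact: gen_congr_trans.
by move=> u u' v v' _ uv _ u'v'; rewrite !mirrorM; exact: gen_congr_mul.
Qed.

Lemma right_cancel (B X Y : H) : X * B = Y * B -> X = Y.
Proof.
rewrite -[B]reprK -[X]reprK -[Y]reprK -!presented_piM.
move=> /presented_eqP /mirror_congr; rewrite !mirrorM.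
move=> /presented_eqP; rewrite !presented_piM => /left_cancel.
by move=> /presented_eqP /mirror_congr; rewrite !mirrorK => /presented_eqP.
Qed.

End Monoid.

Theorem theorem4p4 : forall n : nat, 1 <= n -> cancellative (H_monoid n).
Proof.
move=> n n_gt0 A B X Y AXB; apply: (left_cancel n_gt0 (A := A)).
exact: right_cancel AXB.
Qed.
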